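(* Let $a,b$ be positive integers. Define $c^{(a, b)}_{1} := -K^{\mathfrak{L}}_{(a+1,b-1), (a, b)}$ and, recursively for $2\le i\le b$, \[ c^{(a, b)}_{i} := -\left( K^{\mathfrak{L}}_{(a+i,b-i), (a, b)} + \sum_{j=1}^{i-1} c^{(a, b)}_{j} K^{\mathfrak{L}}_{(a+i,b-i),(a+j,b-j)} \right). \] Then \[ \mathfrak{L}_{(a, b)} = H_{(a, b)} + c_{1}^{(a, b)} H_{(a+1, b-1)} + c_{2}^{(a, b)} H_{(a+2,b-2)} + \cdots + c_{b}^{(a, b)} H_{(a+b)}. \]
   Context: Convention: a tuple with a trailing zero part, such as $(a+b,0)$, is identified with the composition obtained by deleting the zero, e.g. $(a+b)$. A composition $\alpha \vDash n$ is a tuple of positive integers summing to $n$; its diagram has left-justified rows, row $i$ (from the bottom) with $\alpha_i$ cells. A word is a necklace word if it is lexicographically weakly smallest among its cyclic shifts. A lexical tableau of shape $\alpha$ and type $\beta$ is a filling of the diagram of $\alpha$ with positive integers in which $i$ appears $\beta_i$ times, the first column strictly increases from the bottom row upward, and every row read left to right is a necklace word; $K^{\mathfrak{L}}_{\alpha,\beta}$ is their number. $\mathsf{NSym}$ is the algebra of noncommutative symmetric functions over $\mathbb{Q}$ with complete homogeneous basis $\{H_\alpha\}$, dual to the quasisymmetric functions $\mathsf{QSym}$ via $\langle H_\alpha,M_\beta\rangle=\delta_{\alpha,\beta}$ ($M_\beta$ the monomial quasisymmetric functions). The dual lexical function is $\mathfrak{L}^*_\alpha=\sum_T x^T$ over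 lexical tableaux $T$ of shape $\alpha$, where $x^T=\prod_i x_i^{\#\{\text{entries equal to }i\}}$; the lexical basis $\{\mathfrak{L}_\alpha\}$ of $\mathsf{NSym}$ is the unique basis with $\langle\mathfrak{L}_\alpha,\mathfrak{L}^*_\beta\rangle=\delta_{\alpha,\beta}$. *)

(* Defs.v *)
From HB Require Import structures.
From Stdlib Require Import ClassicalEpsilon.
From mathcomp Require Import all_boot all_order all_algebra.
From mathcomp Require Import finmap.
From mathcomp.multinomials Require Import monalg.
From mathcomp Require Import zify.

Set Implicit Arguments.
Unset Strict Implicit.
Unset Printing Implicit Defensive.

Import Order.TTheory GRing.Theory Num.Theory.

Record composition := Composition {
  parts :> seq nat;
  parts_gt0 : all (fun k => 0 < k) parts
}.

HB.instance Definition _ := [isSub for parts].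
HB.instance Definition _ := [Choice of composition by <:].

(* Deletes the zero parts, so that the tuple (a + b, 0) denotes (a + b). *)
Definition comp_of (s : seq nat) : composition :=
  Composition (filter_all (fun k => 0 < k) s).

(* Concatenation makes {malg R[composition]} the free associative algebra
   on the one-part compositions. *)
Definition comp_nil : composition := Composition (isT : all _ [::]).

Fact comp_cat_subproof (s t : composition) : all (fun k => 0 < k) (s ++ t).
Proof. by rewrite all_cat !parts_gt0. Qed.

Definition comp_cat (s t : composition) : composition :=
  Composition (comp_cat_subproof s t).

Fact comp_catA : associative comp_cat.
Proof. by move=> x y z; apply: val_inj => /=; rewrite catA. Qed.

Fact comp_cat0s : left_id comp_nil comp_cat.
Proof. by move=> x; apply: val_inj. Qed.

Fact comp_cats0 : right_id comp_nil comp_cat.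
Proof. by move=> x; apply: val_inj => /=; rewrite cats0. Qed.

Fact comp_cat_eq_nil x y : comp_cat x y = comp_nil -> x = comp_nil /\ y = comp_nil.
Proof.
case: x y => [[|i x] hx] [[|j y] hy] // _; split; exact: val_inj.
Qed.

HB.instance Definition _ := Choice_isMonomialDef.Build composition
  comp_catA comp_cat0s comp_cats0 comp_cat_eq_nil.

Definition necklace (w : seq nat) : bool :=
  all (fun k => ((w : seqlexi nat) <= rot k w)%O) (iota 0 (size w)).

(* A filling of the diagram of alpha with entries in {1, .., N}, as the word of
   its entries read row by row from the bottom; the letter i : 'I_N stands for
   the entry i + 1. *)
Definition filling (alpha : seq nat) (N : nat) := (sumn alpha).-tuple 'I_N.

Definition rows (alpha : seq nat) (N : nat) (T : filling alpha N) :
  seq (seq nat) := reshape alpha [seq (i : nat).+1 | i : 'I_N <- T].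

Definition lexical_tableau (alpha : seq nat) (N : nat) (T : filling alpha N) :
  bool :=
  sorted ltn [seq head 0 r | r <- rows T] && all necklace (rows T).

(* The entries of a filling of type beta are at most size beta. *)
Definition has_type (alpha beta : seq nat) (T : filling alpha (size beta)) :=
  [forall i : 'I_(size beta), count_mem i.+1 (flatten (rows T)) == nth 0 beta i].

Definition Klex (alpha beta : composition) : nat :=
  #|[set T : filling alpha (size beta) | lexical_tableau T & has_type T]|.

(* Formal power series in x_1, x_2, ..., given by their coefficients; the index
   i : nat of a monomial stands for the variable x_{i+1}. *)
Definition series := {cmonom nat} -> rat.

(* x_{s_1 + 1}^{beta_1} x_{s_2 + 1}^{beta_2} ..., for s duplicate-free and of
   the same size as beta *)
Definition xmono (s beta : seq nat) : {cmonom nat} :=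
  [cmonom nth 0 beta (index i s) | i in [fset j | j in s]%fset]%M.

Definition quasisymmetric (F : series) : Prop :=
  forall (beta : composition) (s t : seq nat),
    sorted ltn s -> sorted ltn t ->
    size s = size beta -> size t = size beta ->
    F (xmono s beta) = F (xmono t beta).

Definition bounded_degree (F : series) : Prop :=
  exists d : nat, forall m : {cmonom nat}, d < mdeg m -> F m = 0%R.

Record qsym := QSym {
  qcoef :> {cmonom nat} -> rat;
  qcoef_quasisymmetric : quasisymmetric qcoef;
  qcoef_bounded_degree : bounded_degree qcoef
}.

(* the nonzero exponents of m, by increasing index of the variable *)
Definition exponents (m : {cmonom nat}) : seq nat :=
  [seq m i | i <- sort leq (finsupp m)].

Definition monomial_series (beta : composition) : series :=
  fun m => ((exponents m == beta)%:R)%R.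

Definition xT (alpha : seq nat) (N : nat) (T : filling alpha N) : {cmonom nat} :=
  \big[mmul/mone]_(i <- flatten (rows T)) ucm i.-1.

Definition nvars (m : {cmonom nat}) : nat := \max_(i <- finsupp m) i.+1.

(* The series \sum_T x^T over the lexical tableaux T of shape alpha: the
   T with x^T = m have their entries in {1, .., nvars m}. *)
Definition dual_lexical_series (alpha : composition) : series := fun m =>
  (#|[set T : filling alpha (nvars m) | lexical_tableau T & xT T == m]|%:R)%R.

Lemma xmonoE s beta i : size s = size beta ->
  xmono s beta i = nth 0 beta (index i s).
Proof.
move=> e; rewrite /xmono cmE /= fsfunE !inE /=.
case: ifPn => // h; rewrite nth_default // -e.
by rewrite memNindex.
Qed.

Lemma finsupp_xmono s (beta : composition) : size s = size beta ->
  finsupp (xmono s beta) =i s.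
Proof.
move=> e i; rewrite -cmE_neq0 xmonoE //.
case: (boolP (i \in s)) => h; last by rewrite nth_default ?eqxx // -e memNindex.
have: index i s < size beta by rewrite -e index_mem.
by move=> /(all_nthP 0 (parts_gt0 beta)); rewrite lt0n.
Qed.

Lemma sort_finsupp_xmono s (beta : composition) : sorted ltn s ->
  size s = size beta -> sort leq (finsupp (xmono s beta)) = s.
Proof.
move=> ss e; apply: (sorted_eq leq_trans anti_leq).
- exact/sort_sorted/leq_total.
- by move: ss; rewrite ltn_sorted_uniq_leq => /andP[].
rewrite perm_sort; apply: uniq_perm.
- exact: fset_uniq.
- by move: ss; rewrite ltn_sorted_uniq_leq => /andP[].
- exact: finsupp_xmono.
Qed.

Lemma exponents_xmono s (beta : composition) : sorted ltn s ->
  size s = size beta -> exponents (xmono s beta) = beta.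
Proof.
move=> ss e; rewrite /exponents sort_finsupp_xmono //.
have us : uniq s by move: ss; rewrite ltn_sorted_uniq_leq => /andP[].
apply: (@eq_from_nth _ 0); first by rewrite size_map.
move=> i; rewrite size_map => hi.
by rewrite (nth_map 0) // xmonoE // index_uniq.
Qed.

Lemma quasisymmetric_monomial beta : quasisymmetric (monomial_series beta).
Proof.
move=> gamma s t ss st es et.
by rewrite /monomial_series !exponents_xmono.
Qed.

Lemma mdeg_exponents m : mdeg m = sumn (exponents m).
Proof.
by rewrite mdegE /exponents sumnE big_map (perm_big _ (permEl (perm_sort _ _))).
Qed.

Lemma bounded_degree_monomial beta : bounded_degree (monomial_series beta).
Proof.
exists (sumn beta) => m; rewrite mdeg_exponents /monomial_series.
by case: eqP => [->|//]; rewrite ltnn.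
Qed.

Lemma flatten_rows alpha N (T : filling alpha N) :
  flatten (rows T) = [seq (i : nat).+1 | i : 'I_N <- T].
Proof. by rewrite /rows reshapeKr // size_map size_tuple. Qed.

Lemma shape_rows alpha N (T : filling alpha N) : shape (rows T) = alpha.
Proof. by rewrite /rows reshapeKl // size_map size_tuple. Qed.

Lemma xTE alpha N (T : filling alpha N) i :
  xT T i = count_mem i [seq val j | j <- T].
Proof.
rewrite /xT flatten_rows; elim: (val T) => [|j s IH] /=.
  by rewrite big_nil cm1.
by rewrite big_cons cmM IH cmU.
Qed.

Lemma has_typeP alpha beta (T : filling alpha (size beta)) :
  reflect (forall i, count_mem i [seq val j | j <- T] = nth 0 beta i)
          (has_type T).
Proof.
have E i : count_mem i.+1 (flatten (rows T)) =
           count_mem i [seq val j | j <- T].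
  rewrite flatten_rows (map_comp S) count_map.
  by apply: eq_count => j /=; rewrite eqSS.
apply: (iffP forallP) => [h i|h i]; last by rewrite E h.
case: (ltnP i (size beta)) => hi.
  by have /eqP := h (Ordinal hi); rewrite E.
rewrite nth_default //; apply/count_memPn/negP => /mapP[j _ e].
by move: (ltn_ord j); rewrite -e ltnNge hi.
Qed.

Lemma ltn_nvars (m : {cmonom nat}) (i : nat) : i \in finsupp m -> i < nvars m.
Proof.
rewrite /nvars -[_ \in _]/(i \in enum_fset (finsupp m)).
elim: (enum_fset _) => // j s IH.
rewrite inE big_cons leq_max => /orP[/eqP->|/IH->]; by rewrite ?leqnn ?orbT.
Qed.

Lemma le_lexi_map (f : nat -> nat) (s t : seq nat) :
  {in s & t, {mono f : x y / x <= y}} ->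
  {in t & s, {mono f : x y / x <= y}} ->
  ((map f s : seqlexi nat) <= map f t)%O = ((s : seqlexi nat) <= t)%O.
Proof.
elim: s t => [|x s IH] [|y t] //= h1 h2.
rewrite !lexi_cons IH.
- by rewrite !leEnat h1 ?h2 ?mem_head.
- by move=> a b ha hb; apply: h1; rewrite inE ?ha ?hb orbT.
- by move=> a b ha hb; apply: h2; rewrite inE ?ha ?hb orbT.
Qed.

Lemma necklace_map (f : nat -> nat) (s : seq nat) :
  {in s &, {mono f : x y / x <= y}} -> necklace (map f s) = necklace s.
Proof.
move=> h; rewrite /necklace size_map; apply: eq_all => k.
by rewrite -map_rot le_lexi_map // => x y; rewrite ?mem_rot; apply: h.
Qed.

Definition lexical_rows (r : seq (seq nat)) :=
  sorted ltn [seq head 0 x | x <- r] && all necklace r.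

Lemma lexical_rows_map (f : nat -> nat) (r : seq (seq nat)) :
  all (fun x => 0 < size x) r ->
  {in flatten r &, {mono f : x y / x <= y}} ->
  lexical_rows (map (map f) r) = lexical_rows r.
Proof.
move=> hr h; rewrite /lexical_rows; congr andb.
  have -> : [seq head 0 x | x <- map (map f) r] = map f [seq head 0 x | x <- r].
    rewrite -!map_comp; apply/eq_in_map => x /(allP hr) /=.
    by case: x.
  rewrite sorted_map; apply: (@eq_in_sorted _ (mem [seq head 0 x | x <- r]));
    last exact/allP.
  move=> _ _ /mapP[x hx ->] /mapP[y hy ->] /=.
  rewrite !ltnNge h //; apply/flattenP.
    by exists y => //; have := allP hr y hy; case: (y) => //= *; rewrite mem_head.
  by exists x => //; have := allP hr x hx; case: (x) => //= *; rewrite mem_head.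
rewrite all_map; apply: eq_in_all => x hx /=.
apply: necklace_map => a b ha hb; apply: h; apply/flattenP; by exists x.
Qed.

Lemma rows_gt0 (alpha : composition) N (T : filling alpha N) :
  all (fun x => 0 < size x) (rows T).
Proof.
have := parts_gt0 alpha; rewrite -{1}(shape_rows T) /shape all_map.
by [].
Qed.

Lemma dual_lexical_xmono (alpha beta : composition) s :
  sorted ltn s -> size s = size beta ->
  dual_lexical_series alpha (xmono s beta) = ((Klex alpha beta)%:R)%R.
Proof.
move=> ss es; rewrite /dual_lexical_series /Klex; congr (_%:R)%R.
set m := xmono s beta.
have us : uniq s by move: ss; rewrite ltn_sorted_uniq_leq => /andP[].
have lef : {in [pred n | n < size s] &, {mono nth 0 s : i j / i <= j}}.
  have lt := sorted_ltn_nth ltn_trans 0 ss.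
  move=> i j hi hj; case: (ltngtP i j) => hij.
  - by apply: ltnW; apply: lt.
  - by apply/negbTE; rewrite -ltnNge; apply: lt.
  - by rewrite hij leqnn.
have hf (k : 'I_(size beta)) : nth 0 s k < nvars m.
  by apply: ltn_nvars; rewrite finsupp_xmono // mem_nth // es.
pose f k := Ordinal (hf k).
have f_inj : injective f.
  move=> i j [] /eqP; rewrite nth_uniq ?es // => /eqP; exact: val_inj.
pose F (T : filling alpha (size beta)) : filling alpha (nvars m) :=
  map_tuple f T.
have F_inj : injective F.
  by move=> T U /(congr1 val) /= /(inj_map f_inj) /val_inj.
have FL T : lexical_tableau (F T) = lexical_tableau T.
  have E : rows (F T) = map (map (fun j => (nth 0 s j.-1).+1)) (rows T).
    by rewrite /rows map_reshape -!map_comp.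
  rewrite /lexical_tableau -!/(lexical_rows _) E lexical_rows_map ?rows_gt0 //.
  rewrite flatten_rows => _ _ /mapP[i _ ->] /mapP[j _ ->] /=.
  by rewrite !ltnS lef // inE es.
rewrite -(card_imset _ F_inj); congr #|pred_of_set _|; apply/setP => T.
rewrite inE; apply/andP/imsetP => [[lT /cmP eT]|[U]]; last first.
  rewrite inE => /andP[lU /has_typeP tU] ->; rewrite FL; split=> //.
  apply/cmP => i; rewrite xTE xmonoE //.
  have -> : [seq val j | j <- F U] = map (nth 0 s) [seq val j | j <- U].
    by rewrite /= -!map_comp.
  rewrite count_map; case: (boolP (i \in s)) => hi.
    rewrite -tU; apply: eq_in_count => _ /mapP[j _ ->] /=.
    by rewrite -{1}(nth_index 0 hi) nth_uniq ?index_mem // es.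
  rewrite nth_default -?es ?memNindex //.
  apply/eqP; rewrite -leqn0 leqNgt -has_count; apply/hasPn => _ /mapP[j _ ->] /=.
  by apply: contra hi => /eqP <-; rewrite mem_nth ?es.
have hT (j : 'I_(nvars m)) : j \in T -> (j : nat) \in s.
  move=> hj; rewrite -(finsupp_xmono es) -cmE_neq0 -eT xTE -lt0n -has_count.
  by apply/hasP; exists (val j) => //=; apply: map_f.
pose g (j : 'I_(nvars m)) : option 'I_(size beta) := insub (index (j : nat) s).
have gK j : j \in T -> exists2 k, g j = Some k & f k = j.
  move=> /hT hj; rewrite /g; case: insubP => [k _ ek|]; last first.
    by move=> hN; exfalso; move: hN; rewrite -es index_mem hj.
  by exists k => //; apply: val_inj; rewrite /= ek nth_index.
have szU : size (pmap g T) == sumn alpha.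
  rewrite size_pmap -[X in _ == X](size_tuple T) -all_count.
  by apply/allP => j /gK[k ->].
pose U : filling alpha (size beta) := Tuple szU.
have FU : T = F U.
  apply: val_inj => /=.
  have {}gK : forall j, j \in tval T -> exists2 k, g j = Some k & f k = j by [].
  elim: (tval T) gK => //= j t IH gK.
  have [k gj fk] := gK j (mem_head _ _).
  rewrite gj /= fk -IH // => i hi; apply: gK; by rewrite inE hi orbT.
exists U => //; rewrite inE -FL -FU lT /=; apply/has_typeP => i.
case: (ltnP i (size beta)) => hi.
  have := eT (nth 0 s i); rewrite xTE xmonoE // index_uniq ?es // => <-.
  have -> : [seq val j | j <- T] = map (nth 0 s) [seq val j | j <- U].
    by rewrite FU /= -!map_comp.
  rewrite [RHS]count_map; apply: eq_in_count => _ /mapP[j _ ->] /=.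
  by rewrite nth_uniq ?es.
rewrite nth_default //; apply/count_memPn/negP => /mapP[j _ e].
by move: (ltn_ord j); rewrite -[X in X < _]e ltnNge hi.
Qed.

Lemma quasisymmetric_dual_lexical alpha :
  quasisymmetric (dual_lexical_series alpha).
Proof.
by move=> beta s t ss st es et; rewrite !dual_lexical_xmono.
Qed.

Lemma mdeg_xT alpha N (T : filling alpha N) : mdeg (xT T) = sumn alpha.
Proof.
rewrite /xT mdeg_prod flatten_rows big_map.
under eq_bigr do rewrite mdegU.
by rewrite sum1_size size_tuple.
Qed.

Lemma bounded_degree_dual_lexical alpha :
  bounded_degree (dual_lexical_series alpha).
Proof.
exists (sumn alpha) => m hm; rewrite /dual_lexical_series.
suff -> : [set T : filling alpha (nvars m) | lexical_tableau T & xT T == m] = set0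
  by rewrite cards0.
apply/setP => T; rewrite !inE; apply/negP => /andP[_ /eqP e].
by move: hm; rewrite -e mdeg_xT ltnn.
Qed.

Definition qsymM (beta : composition) : qsym :=
  QSym (@quasisymmetric_monomial beta) (@bounded_degree_monomial beta).

Definition dual_lexical (alpha : composition) : qsym :=
  QSym (@quasisymmetric_dual_lexical alpha) (@bounded_degree_dual_lexical alpha).

Local Open Scope ring_scope.

Notation NSym := {malg rat[composition]}.

Definition nsymH (alpha : composition) : NSym := << alpha >>.

(* x_1^{alpha_1} ... x_k^{alpha_k}; its coefficient in a quasisymmetric F is
   the coefficient of F on qsymM alpha. *)
Definition xcomp (alpha : seq nat) : {cmonom nat} :=
  xmono (iota 0 (size alpha)) alpha.

Definition pairing (f : NSym) (F : qsym) : rat :=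
  \sum_(alpha <- msupp f) f@_alpha * F (xcomp alpha).

Definition is_basis (B : composition -> NSym) : Prop :=
  forall f : NSym, exists! c : {malg rat[composition]},
    f = \sum_(alpha <- msupp c) c@_alpha *: B alpha.

Definition is_lexical_basis (L : composition -> NSym) : Prop :=
  is_basis L /\
  (forall alpha beta, pairing (L alpha) (dual_lexical beta) = (alpha == beta)%:R).

Lemma nsymH_mul alpha beta : nsymH alpha * nsymH beta = nsymH (mmul alpha beta).
Proof. by rewrite malgM_def fgmulUU mulr1. Qed.

Lemma pairing_linearl (c : rat) (f g : NSym) (F : qsym) :
  pairing (c *: f + g) F = c * pairing f F + pairing g F.
Proof.
have E h : pairing h F = mmap idfun (fun alpha : composition => F (xcomp alpha)) h by [].
rewrite !E mmapD (mmapEw (msuppZ_le c f)) mmapE mulr_sumr; congr (_ + _).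
by apply: eq_bigr => a _; rewrite mcoeffZ mulrA.
Qed.

Lemma pairing_linearr f c (F G E : qsym) :
  (forall m, E m = c * F m + G m) -> pairing f E = c * pairing f F + pairing f G.
Proof.
move=> h; rewrite /pairing mulr_sumr -big_split; apply: eq_bigr => a _ /=.
by rewrite h mulrDr !mulrA (mulrC c).
Qed.

Lemma pairing_H alpha F : pairing (nsymH alpha) F = F (xcomp alpha).
Proof.
have -> : pairing (nsymH alpha) F = mmap idfun (fun alpha : composition => F (xcomp alpha)) (nsymH alpha) by [].
by rewrite mmapU /= mul1r.
Qed.

Lemma pairing_HM alpha beta : pairing (nsymH alpha) (qsymM beta) = (alpha == beta)%:R.
Proof.
rewrite pairing_H /= /monomial_series exponents_xmono ?size_iota //.
exact: iota_ltn_sorted.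
Qed.

Lemma qsym_exponents (F : qsym) m : F m = F (xcomp (exponents m)).
Proof.
have pos : all (fun k => 0 < k)%N (exponents m).
  apply/allP => _ /mapP[i hi ->]; rewrite lt0n cmE_neq0.
  by rewrite mem_sort in hi.
have sz : size (sort leq (finsupp m)) = size (Composition pos) by rewrite size_map.
have us : uniq (sort leq (finsupp m)) by rewrite sort_uniq fset_uniq.
have -> : F m = F (xmono (sort leq (finsupp m)) (Composition pos)).
  congr (F _); apply/eqP/cmP => i; rewrite xmonoE //=.
  have [hi|hi] := boolP (i \in sort leq (finsupp m)).
    by rewrite (nth_map 0%N) ?index_mem // nth_index.
  rewrite nth_default ?size_map ?memNindex //.
  by apply/eqP; rewrite cmE_eq0 -[_ \notin _]/(i \notin enum_fset (finsupp m)) -(mem_sort leq).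
apply: qcoef_quasisymmetric; rewrite ?size_iota //.
  by rewrite ltn_sorted_uniq_leq us sort_sorted //; apply: leq_total.
exact: iota_ltn_sorted.
Qed.

Lemma pairing_H_dual_lexical beta alpha :
  pairing (nsymH beta) (dual_lexical alpha) = (Klex alpha beta)%:R.
Proof.
rewrite pairing_H /= dual_lexical_xmono ?size_iota //; exact: iota_ltn_sorted.
Qed.

(* The lexical basis exists and is unique because the matrix Klex is triangular
   for the dominance order, with nonzero diagonal entries. *)

Local Close Scope ring_scope.

Lemma necklace_head w x : necklace w -> x \in w -> (head 0 w <= x).
Proof.
move=> /allP hw hx; have hi : (index x w < size w) by rewrite index_mem.
have := hw (index x w); rewrite mem_iota /= => /(_ hi).
rewrite /rot (drop_nth 0 hi) nth_index //.
by case: w {hw hi} hx => //= y w _; rewrite lexi_cons => /andP[].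
Qed.

Lemma sorted_ltn_nth_gt (s : seq nat) i : sorted ltn s -> all (leq 1) s ->
  (i < size s) -> (i < nth 0 s i).
Proof.
move=> ss ps; elim: i => [|i IH] hi; first by apply: (all_nthP 0 ps).
have := sorted_ltn_nth ltn_trans 0 ss i i.+1 (ltnW hi) hi (ltnSn i).
by move=> /=; apply: leq_ltn_trans; apply: IH; apply: ltnW.
Qed.

Lemma sumn_take_nth (s : seq nat) j :
  sumn (take j.+1 s) = (sumn (take j s) + nth 0 s j).
Proof.
elim: s j => [|x s IH] [|j] //=; first by rewrite take0 /= addn0.
by rewrite IH addnA.
Qed.

Lemma count_lt_type (w beta : seq nat) j :
  (forall i, count_mem i w = nth 0 beta i) ->
  count (fun x => x < j) w = sumn (take j beta).
Proof.
move=> h; elim: j => [|j IH]; first by rewrite take0 /= (@eq_count _ _ pred0) ?count_pred0.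
rewrite sumn_take_nth -IH -h -(count_predUI _ (pred1 j)).
rewrite [X in (_ + X)](@eq_count _ _ pred0) ?count_pred0 ?addn0; last first.
  by move=> x /=; case: eqP => [->|_]; rewrite ?ltnn ?andbF.
by apply: eq_count => x /=; rewrite ltnS leq_eqVlt orbC.
Qed.

Lemma row_gt (alpha : composition) N (T : filling alpha N) i x :
  lexical_tableau T -> (i < size alpha) -> x \in nth [::] (rows T) i ->
  (i < x).
Proof.
move=> /andP[ss nn] hi hx.
have sr : size (rows T) = size alpha by rewrite -(size_map size) -/(shape _) shape_rows.
have hr : nth [::] (rows T) i \in rows T by rewrite mem_nth // sr.
apply: leq_trans (necklace_head (allP nn _ hr) hx).
have := @sorted_ltn_nth_gt _ i ss _ _; rewrite size_map sr => /(_ _ hi).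
rewrite (nth_map [::]) ?sr //; apply.
apply/allP => _ /mapP[r r_in ->].
have := allP (rows_gt0 T) r r_in; case: r r_in => // y r r_in _ /=.
have : y \in flatten (rows T) by apply/flattenP; exists (y :: r) => //; apply: mem_head.
by rewrite flatten_rows => /mapP[j _ ->].
Qed.

Lemma Klex_neq0P alpha beta : Klex alpha beta != 0 ->
  exists2 T : filling alpha (size beta), lexical_tableau T & has_type T.
Proof.
rewrite /Klex -lt0n card_gt0 => /set0Pn[T]; rewrite inE => /andP[lT tT].
by exists T.
Qed.

Lemma Klex_sumn alpha beta : Klex alpha beta != 0 -> sumn alpha = sumn beta.
Proof.
move=> /Klex_neq0P[T _ /has_typeP /(count_lt_type (size beta))].
rewrite take_size => <-; rewrite (@eq_in_count _ _ predT).
  by rewrite count_predT size_map size_tuple.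
by move=> _ /mapP[j _ ->] /=; rewrite ltn_ord.
Qed.

Lemma Klex_dominance alpha beta j : Klex alpha beta != 0 ->
  (sumn (take j beta) <= sumn (take j alpha)).
Proof.
move=> /Klex_neq0P[T lT /has_typeP /(count_lt_type j) <-].
have -> : count (fun x => x < j) [seq val i | i <- T] =
          count (fun x => x <= j) (flatten (rows T)).
  by rewrite flatten_rows !count_map.
rewrite -(cat_take_drop j (rows T)) flatten_cat count_cat.
rewrite [X in (_ + X)](_ : _ = 0) ?addn0; last first.
  apply/eqP; rewrite -leqn0 leqNgt -has_count; apply/hasPn => x /flattenP[r].
  move=> /(nthP [::])[i]; rewrite size_drop nth_drop => hi <- hx.
  rewrite -ltnNge; apply: leq_ltn_trans (leq_addr i j) _.
  apply: row_gt hx => //.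
  by rewrite -(shape_rows T) size_map -ltn_subRL.
apply: leq_trans (count_size _ _) _.
by rewrite size_flatten /shape map_take -/(shape _) shape_rows.
Qed.

Definition superstd (alpha : seq nat) : seq 'I_(size alpha) :=
  flatten [seq nseq (nth 0 alpha i) i | i : 'I_(size alpha) <- enum 'I_(size alpha)].

Lemma Klex_diag alpha : Klex alpha alpha != 0.
Proof.
have En : [seq nth 0 alpha i | i : 'I_(size alpha) <- enum 'I_(size alpha)] = alpha.
  by rewrite (map_comp (nth 0 alpha) val) val_enum_ord map_nth_iota0 ?take_size.
have hs : size (superstd alpha) == sumn alpha.
  rewrite size_flatten /shape -map_comp; apply/eqP; congr sumn; rewrite -[RHS]En.
  by apply: eq_map => i /=; rewrite size_nseq.
pose T : filling alpha (size alpha) := Tuple hs.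
have rT : rows T = [seq nseq (nth 0 alpha i) i.+1 | i <- iota 0 (size alpha)].
  rewrite /rows /= /superstd map_flatten -map_comp -val_enum_ord -map_comp.
  set r := (X in flatten X).
  have {1}-> : parts alpha = shape r.
    rewrite -[LHS]En /shape /r -map_comp; apply: eq_map => i /=.
    by rewrite size_map size_nseq.
  by rewrite flattenK /r; apply: eq_map => i /=; rewrite map_nseq.
rewrite /Klex -lt0n card_gt0; apply/set0Pn; exists T.
rewrite inE; apply/andP; split.
  rewrite /lexical_tableau rT; apply/andP; split.
    rewrite -map_comp (@eq_in_map _ _ _ S (iota 0 (size alpha))).1.
      by rewrite sorted_map; apply: iota_ltn_sorted.
    move=> i; rewrite mem_iota /= => hi.
    by have /(_ i hi) := (all_nthP 0 (parts_gt0 alpha)); case: nth.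
  apply/allP => _ /mapP[i _ ->]; apply/allP => k _.
  suff -> : rot k (nseq (nth 0 alpha i) i.+1) = nseq (nth 0 alpha i) i.+1 by [].
  have /all_pred1P -> : all (pred1 i.+1) (rot k (nseq (nth 0 alpha i) i.+1)).
    by apply/allP => x; rewrite mem_rot mem_nseq => /andP[].
  by rewrite size_rot size_nseq.
apply/forallP => i; rewrite rT count_flatten -map_comp.
rewrite sumnE big_map (bigD1_seq (i : nat)) ?mem_iota ?iota_uniq //=.
rewrite count_nseq /= eqxx mul1n big1 ?addn0 // => j hj.
by rewrite /= count_nseq /= eqSS (negbTE hj).
Qed.

Definition dsum (alpha : seq nat) : nat :=
  (\sum_(j < (sumn alpha).+1) sumn (take j alpha)).

Lemma size_le_sumn (alpha : composition) : (size alpha <= sumn alpha).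
Proof.
case: alpha => s /=; elim: s => //= x s IH /andP[hx /IH hs].
by rewrite -add1n leq_add.
Qed.

Lemma comp_eq_nth (alpha beta : composition) :
  (forall j, nth 0 alpha j = nth 0 beta j) -> alpha = beta.
Proof.
move=> h; apply: val_inj => /=.
suff hs : size alpha = size beta by apply: (eq_from_nth hs) => i _; apply: h.
apply/eqP; rewrite eqn_leq; apply/andP; split; rewrite leqNgt; apply/negP => hlt.
  have := all_nthP 0 (parts_gt0 alpha) _ hlt.
  by rewrite h nth_default.
have := all_nthP 0 (parts_gt0 beta) _ hlt.
by rewrite -h nth_default.
Qed.

Lemma Klex_dsum alpha beta : Klex alpha beta != 0 -> alpha != beta ->
  (dsum beta < dsum alpha).
Proof.
move=> hK hne; have hs := Klex_sumn hK; rewrite /dsum hs.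
rewrite (ltn_leqif (leqif_sum (fun (j : 'I_(sumn beta).+1) _ => leqif_eq (Klex_dominance j hK)))).
apply: contra hne => /forallP h; apply/eqP; apply: comp_eq_nth => j.
have {}h i : sumn (take i beta) = sumn (take i alpha).
  case: (ltnP i (sumn beta).+1) => hi; first by have /eqP := h (Ordinal hi).
  rewrite !take_oversize //; apply: leq_trans (size_le_sumn _) _.
    by rewrite hs ltnW.
  exact: ltnW.
by have := h j.+1; rewrite !sumn_take_nth h => /addnI.
Qed.

Lemma dsum_le alpha : (dsum alpha <= (sumn alpha).+1 * sumn alpha).
Proof.
rewrite /dsum -[X in (_ <= X * _)]card_ord -sum_nat_const.
apply: leq_sum => j _.
by rewrite -[X in _ <= sumn X](cat_take_drop j) sumn_cat leq_addr.
Qed.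

Local Open Scope ring_scope.

Lemma pairing_dual_lexical f gamma :
  pairing f (dual_lexical gamma) =
  \sum_(beta <- msupp f) f@_beta * (Klex gamma beta)%:R.
Proof.
by apply: eq_bigr => b _; rewrite -pairing_H pairing_H_dual_lexical.
Qed.

Lemma pairing_dual_lexical_inj f :
  (forall gamma, pairing f (dual_lexical gamma) = 0) -> f = 0.
Proof.
move=> h; apply/eqP; rewrite -msupp_eq0; apply/negPn/negP => /fset0Pn[b0 hb0].
pose P n := has (fun b : composition => dsum b == n) (msupp f).
have exP : exists n, P n.
  by exists (dsum b0); apply/hasP; exists b0.
case: (ex_minnP exP) => n /hasP[g hg /eqP <-] hmin.
have := h g; rewrite pairing_dual_lexical (bigD1_seq g) ?fset_uniq //=.
rewrite big_seq_cond big1 ?addr0 => [|b /andP[hb hne]].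
  move=> /eqP; rewrite mulf_eq0 mcoeff_eq0 hg /= pnatr_eq0.
  by rewrite (negbTE (Klex_diag g)).
apply/eqP; rewrite mulf_eq0 pnatr_eq0 orbC; apply/orP; left.
apply/negPn/negP => hK; have := Klex_dsum hK; rewrite eq_sym => /(_ hne).
by rewrite ltnNge hmin //; apply/hasP; exists b.
Qed.

Definition comps (n : nat) : seq composition :=
  undup (pmap insub (flatten [seq [seq map val (tval t) | t : k.-tuple 'I_n.+1 <- enum {: k.-tuple 'I_n.+1}] | k <- iota 0 n.+1])).

Lemma mem_comps (alpha : composition) : alpha \in comps (sumn alpha).
Proof.
rewrite mem_undup mem_pmap; apply/mapP; exists (parts alpha); last by rewrite valK.
apply/flatten_mapP; exists (size alpha).
  by rewrite mem_iota /= add0n ltnS size_le_sumn.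
have hle x : x \in parts alpha -> (x < (sumn alpha).+1)%N.
  rewrite ltnS; elim: (parts alpha) => //= y s IH.
  by rewrite inE => /orP[/eqP->|/IH h]; rewrite ?leq_addr // (leq_trans h) ?leq_addl.
have hsz : size [seq (inord x : 'I_(sumn alpha).+1) | x <- parts alpha] == size alpha.
  by rewrite size_map.
apply/mapP; exists (Tuple hsz); first by rewrite mem_enum.
rewrite /= -map_comp -[LHS]map_id; apply/eq_in_map => x /hle hx /=.
by rewrite inordK.
Qed.

Fixpoint lexrec (k : nat) (beta : composition) : NSym :=
  if k is k'.+1 then
    ((Klex beta beta)%:R : rat)^-1 *:
      (nsymH beta - \sum_(alpha <- comps (sumn beta) | alpha != beta)
                  ((Klex alpha beta)%:R : rat) *: lexrec k' alpha)
  else 0.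

Lemma pairing0 F : pairing 0 F = 0.
Proof. by rewrite /pairing msupp0 big_nil. Qed.

Lemma pairingZ c f F : pairing (c *: f) F = c * pairing f F.
Proof. by rewrite -[c *: f]addr0 pairing_linearl pairing0 addr0. Qed.

Lemma pairingD f g F : pairing (f + g) F = pairing f F + pairing g F.
Proof. by rewrite -[f]scale1r pairing_linearl scale1r mul1r. Qed.

Lemma pairingB f g F : pairing (f - g) F = pairing f F - pairing g F.
Proof. by rewrite -scaleN1r pairingD pairingZ mulN1r. Qed.

Lemma pairing_sum (I : Type) (r : seq I) (P : pred I) (E : I -> NSym) F :
  pairing (\sum_(i <- r | P i) E i) F = \sum_(i <- r | P i) pairing (E i) F.
Proof.
exact: (big_morph (pairing^~ F) (fun f g => pairingD f g F) (pairing0 F)).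
Qed.

Lemma lexrecP k (beta gamma : composition) :
  ((sumn beta).+1 * sumn beta - dsum beta < k)%N ->
  pairing (lexrec k beta) (dual_lexical gamma) = (beta == gamma)%:R.
Proof.
elim: k beta gamma => // k IH beta gamma hk /=.
rewrite pairingZ pairingB pairing_H_dual_lexical pairing_sum.
have -> : \sum_(a <- comps (sumn beta) | a != beta)
   pairing ((Klex a beta)%:R *: lexrec k a) (dual_lexical gamma) =
   \sum_(a <- comps (sumn beta) | a != beta) (Klex a beta)%:R * (a == gamma)%:R.
  apply: eq_bigr => a hne; rewrite pairingZ.
  have [->|hK] := eqVneq (Klex a beta) 0%N; first by rewrite !mul0r.
  rewrite IH //; have hs := Klex_sumn hK; have hd := Klex_dsum hK hne.
  have := dsum_le a; have := dsum_le beta; rewrite hs; lia.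
have hdiag : (Klex beta beta)%:R != 0 :> rat by rewrite pnatr_eq0 Klex_diag.
have [<-|hne] := eqVneq beta gamma.
  by rewrite big1 => [|a /negbTE ->]; rewrite ?mulr0 // subr0 mulVf.
have -> : \sum_(a <- comps (sumn beta) | a != beta) (Klex a beta)%:R * (a == gamma)%:R
    = (Klex gamma beta)%:R :> rat; last by rewrite subrr mulr0.
rewrite big_mkcond; have [hin|hout] := boolP (gamma \in comps (sumn beta)).
  rewrite (bigD1_seq gamma) ?undup_uniq //= eq_sym hne eqxx mulr1 big1 ?addr0 //.
  by move=> a /negbTE ->; rewrite mulr0 if_same.
have -> : Klex gamma beta = 0%N.
  apply/eqP/negPn/negP => /Klex_sumn hs.
  by move: hout; rewrite -hs mem_comps.
rewrite big_seq big1 // => a ha; have [e|_] := eqVneq a gamma; last by rewrite mulr0 if_same.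
by move: hout; rewrite -e ha.
Qed.

Lemma dual_lexical_basis (L : composition -> NSym) :
  (forall alpha beta, pairing (L alpha) (dual_lexical beta) = (alpha == beta)%:R) ->
  is_basis L.
Proof.
move=> hL f.
have coef (c : NSym) g :
    pairing (\sum_(a <- msupp c) c@_a *: L a) (dual_lexical g) = c@_g.
  rewrite pairing_sum; under eq_bigr do rewrite pairingZ hL.
  have [hg|hg] := boolP (g \in msupp c).
    rewrite (bigD1_seq g) ?fset_uniq //= eqxx mulr1 big1 ?addr0 //.
    by move=> a /negbTE ->; rewrite mulr0.
  rewrite (mcoeff_outdom hg) big_seq big1 // => a ha.
  by case: eqP hg => [<-|_]; rewrite ?ha ?mulr0.
pose D : {fset composition} :=
  [fset a | a in flatten [seq comps (sumn (parts b)) | b <- msupp f]]%fset.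
pose c : NSym := [malg a in D => pairing f (dual_lexical a)].
have cE a : c@_a = pairing f (dual_lexical a).
  rewrite mcoeffE; case: ifPn => // ha; rewrite pairing_dual_lexical.
  rewrite big_seq big1 // => b hb; apply/eqP; rewrite mulf_eq0 pnatr_eq0.
  apply/orP; right; apply/negPn/negP => /Klex_sumn hs.
  move: ha; rewrite !inE /= => /negP; apply; apply/flatten_mapP.
  by exists b => //; rewrite -hs mem_comps.
exists c; split.
  apply/eqP; rewrite -subr_eq0; apply/eqP; apply: pairing_dual_lexical_inj => g.
  by rewrite pairingB coef cE subrr.
move=> c' e; apply/malgP => g; by rewrite cE e coef.
Qed.

Lemma lexical_basis_exists : exists L, is_lexical_basis L.
Proof.
exists (fun b : composition => lexrec ((sumn b).+1 * sumn b).+1 b).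
have h (a b : composition) : pairing (lexrec ((sumn a).+1 * sumn a).+1 a) (dual_lexical b)
             = (a == b)%:R by rewrite lexrecP // ltnS leq_subr.
by split=> //; apply: dual_lexical_basis.
Qed.

Lemma lexical_basis_unique L L' :
  is_lexical_basis L -> is_lexical_basis L' -> L =1 L'.
Proof.
move=> [_ hL] [_ hL'] a; apply/eqP; rewrite -subr_eq0; apply/eqP.
by apply: pairing_dual_lexical_inj => g; rewrite pairingB hL hL' subrr.
Qed.

Definition lexical : composition -> NSym :=
  proj1_sig (constructive_indefinite_description _ lexical_basis_exists).

Lemma lexicalP : is_lexical_basis lexical.
Proof. exact: proj2_sig (constructive_indefinite_description _ _). Qed.

(* Main.v *)
(** An element of NSym is determined by its pairings with the dual lexical
    functions, and [H_beta] pairs with [L*_alpha] to [Klex alpha beta].  If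
    [Klex alpha (a, b)] is nonzero, then [alpha] dominates [(a, b)], so it is some
    [(a + k, b - k)].  Moreover [Klex alpha alpha = 1].  Hence the recursion
    defining the coefficients [c i] says exactly that the right-hand side pairs
    to zero with every dual lexical function other than that of [(a, b)]. *)

Require Import Defs.
From mathcomp Require Import all_boot all_order all_algebra.
From mathcomp.multinomials Require Import monalg.
From mathcomp Require Import zify.
Import GRing.Theory.

Lemma rows_inj (alpha : seq nat) (N : nat) : injective (@rows alpha N).
Proof.
move=> T U /(congr1 flatten); rewrite !flatten_rows => e.
by apply/val_inj/(inj_map _ e) => i j [/val_inj].
Qed.

(* The i first rows of T have as many cells as T has entries at most i, and no
   such entry lies in a higher row. *)
Lemma diag_row_le (alpha : composition) (T : filling alpha (size alpha)) i x :
  lexical_tableau T -> has_type T ->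
  x \in flatten (take i (rows T)) -> x <= i.
Proof.
move=> lT /has_typeP /(count_lt_type i) hc.
have hdrop : count (fun y => y <= i) (flatten (drop i (rows T))) = 0.
  apply/eqP; rewrite -leqn0 leqNgt -has_count; apply/hasPn => y /flattenP[r].
  move=> /(nthP [::])[j]; rewrite size_drop nth_drop => hj <- hy.
  rewrite -ltnNge; apply: leq_ltn_trans (leq_addr j i) _.
  apply: row_gt hy => //.
  by rewrite -(shape_rows T) size_map -ltn_subRL.
have : count (fun y => y <= i) (flatten (rows T)) = sumn (take i alpha).
  by rewrite -hc flatten_rows !count_map.
rewrite -(cat_take_drop i (rows T)) flatten_cat count_cat hdrop addn0.
have -> : sumn (take i alpha) = size (flatten (take i (rows T))).
  by rewrite size_flatten /shape map_take -/(shape _) shape_rows.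
by rewrite cat_take_drop => /eqP; rewrite -all_count => /allP; apply.
Qed.

(** The bounds meet: [row_gt] gives [i < x], and [diag_row_le] for the first [i.+1] rows gives
    [x <= i.+1]. *)
Lemma diag_row (alpha : composition) (T : filling alpha (size alpha)) i x :
  lexical_tableau T -> has_type T -> i < size alpha ->
  x \in nth [::] (rows T) i -> x = i.+1.
Proof.
move=> lT tT hi hx; apply/eqP; rewrite eqn_leq (row_gt lT hi hx) andbT.
have sr : size (rows T) = size alpha by rewrite -(size_map size) -/(shape _) shape_rows.
apply: (diag_row_le _ _ _ _ lT tT); apply/flattenP; exists (nth [::] (rows T) i) => //.
by rewrite -(nth_take _ (ltnSn i)) mem_nth // size_take sr; case: ifP.
Qed.

Lemma diag_rows (alpha : composition) (T : filling alpha (size alpha)) :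
  lexical_tableau T -> has_type T ->
  rows T = [seq nseq (nth 0 alpha i) i.+1 | i <- iota 0 (size alpha)].
Proof.
move=> lT tT.
have sr : size (rows T) = size alpha by rewrite -(size_map size) -/(shape _) shape_rows.
apply: (@eq_from_nth _ [::]) => [|i]; rewrite sr ?size_map ?size_iota // => hi.
rewrite (nth_map 0) ?size_iota // nth_iota // add0n.
have -> : nth 0 alpha i = size (nth [::] (rows T) i).
  by rewrite -(nth_map [::] 0) ?sr // -/(shape _) shape_rows.
apply/all_pred1P/allP => x /=.
by move=> /(diag_row _ _ _ _ lT tT hi) ->.
Qed.

(** [diag_rows] determines every row, so there is at most one tableau; [Klex_diag] supplies one. *)
Lemma Klex_diag1 (alpha : composition) : Klex alpha alpha = 1.
Proof.
apply/eqP; rewrite eqn_leq lt0n Klex_diag andbT.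
apply/card_le1_eqP => T U; rewrite !inE => /andP[lT tT] /andP[lU tU].
by apply: rows_inj; rewrite !diag_rows.
Qed.

(** Dominance makes the first part at least [a] and lets the first two parts exhaust the total
    [a + b], which leaves no room for a third. *)
Lemma Klex_two_parts (alpha : composition) (a b : nat) : 0 < a ->
  Klex alpha (comp_of [:: a; b]) != 0 ->
  exists2 k, k <= b & alpha = comp_of [:: a + k; b - k].
Proof.
move=> ha hK; have hs := Klex_sumn hK.
have h1 := Klex_dominance 1 hK; have h2 := Klex_dominance 2 hK.
have hsb : sumn (comp_of [:: a; b]) = a + b.
  by rewrite /= ha; case: (b) => /=; lia.
have {}h1 : a <= sumn (take 1 alpha) by move: h1; rewrite /= ha /= take0 /= addn0.
have {}h2 : a + b <= sumn (take 2 alpha).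
  by move: h2; rewrite -hsb take_oversize //= ha; case: (b).
rewrite hsb in hs; case: alpha hs h1 h2 {hK} => [] [|x [|y [|z s]]] pos /=.
- lia.
(* A single part is [a + b]: take [k = b], whose zero second part [comp_of] deletes. *)
- move=> hs _ _; exists b => //; apply: val_inj => /=.
  by rewrite subnn addn_gt0 ha /=; congr [:: _]; lia.
- have /= /and3P[hx hy _] := pos => hs h1 _; exists (x - a); first by lia.
  apply: val_inj => /=; have -> : 0 < a + (x - a) by lia.
  have -> : 0 < b - (x - a) by lia.
  by congr [:: _; _]; lia.
- have /= /and4P[_ _ hz _] := pos; lia.
Qed.

Local Open Scope ring_scope.

Theorem theorem4p13 (a b : nat) (ha : (0 < a)%N) (hb : (0 < b)%N)
  (c : nat -> rat)
  (hc1 : c 1%N =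
     - (Klex (comp_of [:: a + 1; b - 1]%N) (comp_of [:: a; b]))%:R)
  (hc : forall i : nat, (2 <= i <= b)%N ->
     c i = - ((Klex (comp_of [:: a + i; b - i]%N) (comp_of [:: a; b]))%:R +
              \sum_(1 <= j < i)
                c j * (Klex (comp_of [:: a + i; b - i]%N)
                            (comp_of [:: a + j; b - j]%N))%:R)) :
  lexical (comp_of [:: a; b]) =
    nsymH (comp_of [:: a; b]) +
    \sum_(1 <= i < b.+1) c i *: nsymH (comp_of [:: a + i; b - i]%N).
Proof.
pose C i := comp_of [:: a + i; b - i]%N.
have C0 : comp_of [:: a; b] = C 0%N by rewrite /C addn0 subn0.
(* The part [a + i] is positive, so [comp_of] keeps it even when [b - i] is zero, and [C i]
   determines [i]. *)
have headC i : nth 0%N (C i) 0 = (a + i)%N by rewrite /= addn_gt0 ha.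
(* Triangularity: [H_(C j)] pairs nontrivially only with the dual functions of [C k] for
   [j <= k <= b]. *)
have K0 g j : (j <= b)%N ->
    (forall k, (j <= k <= b)%N -> g != C k) -> Klex g (C j) = 0%N.
  move=> hj hg; apply/eqP/negPn/negP => hK.
  have aj : (0 < a + j)%N by rewrite addn_gt0 ha.
  have [k hk e] := Klex_two_parts _ _ _ aj hK.
  have jk : (j <= j + k <= b)%N by lia.
  by have /eqP := hg _ jk; apply; rewrite e /C addnA subnDA.
(* For [i = 1] the inner sum is empty, so one formula covers both clauses of the recursion. *)
have {hc1}hc i : (1 <= i <= b)%N ->
    c i = - ((Klex (C i) (C 0%N))%:R +
             \sum_(1 <= j < i) c j * (Klex (C i) (C j))%:R).
  case: i => [//|[_|i hi]]; last by rewrite hc // C0.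
  by rewrite big_geq // addr0 hc1 C0.
rewrite C0; apply/eqP; rewrite -subr_eq0; apply/eqP.
apply: pairing_dual_lexical_inj => g; rewrite pairingB lexicalP.2.
rewrite pairingD pairing_H_dual_lexical pairing_sum.
under eq_bigr do rewrite pairingZ pairing_H_dual_lexical -/(C _).
have [/hasP[k]|/hasPn hg] := boolP (has (fun k => g == C k) (iota 0 b.+1)); last first.
  have {}hg k : (k <= b)%N -> g != C k by move=> hk; apply: hg; rewrite mem_iota.
  rewrite (eq_sym (C 0%N)) (negbTE (hg _ _)) // K0 //.
  rewrite add0r big_nat big1 ?subrr // => i /andP[_ hi].
  by rewrite K0 ?mulr0 // => k /andP[_ /hg].
rewrite mem_iota /= add0n ltnS => hk /eqP -> {g}.
have CI i : C k = C i -> k = i.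
  by move=> e; have := headC k; rewrite e headC => /addnI.
have Kgt i : (k < i <= b)%N -> Klex (C k) (C i) = 0%N.
  move=> /andP[ki ib]; apply: K0 => // l /andP[il _].
  by apply/eqP => /CI; lia.
have tail0 : \sum_(k.+1 <= i < b.+1) c i * (Klex (C k) (C i))%:R = 0.
  by rewrite big_nat big1 // => i hi; rewrite Kgt ?mulr0.
case: k hk CI {Kgt} tail0 => [_ _ ->|k hk CI tail0].
  by rewrite eqxx Klex_diag1 addr0 subrr.
(* The index is now [k.+1]. Terms beyond it vanish, and its own term is [c k.+1] since the diagonal
   entry is 1; the recursion makes this cancel all earlier terms. *)
rewrite (@big_cat_nat _ _ _ k.+2) //= tail0 addr0 big_nat_recr //= Klex_diag1.
rewrite mulr1 (hc k.+1) // addrA subrr subr0.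
by case: eqP => // /esym /CI.
Qed.
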